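(* Let $p$ be a prime, let $a\in\mathbb{Z}$, and let $l,l',m$ be positive integers with $l'\geqslant l>m/p$ and $$l'\equiv l \pmod{(p-1)p^{\lfloor\log_p m\rfloor-\delta_p(a,m)}},$$ where $\delta_p(a,m)=1$ if $p\mid a$ and $\log_p m$ is a positive integer, and $\delta_p(a,m)=0$ otherwise. Then $$\sum_{j=0}^{l'}\binom{l'}{j}S(j,m)a^{l'-j}\equiv\sum_{j=0}^{l}\binom{l}{j}S(j,m)a^{l-j}\pmod p.$$
   Context: $S(j,m)$ denotes the Stirling number of the second kind: for $j+m>0$ it is the number of ways to partition a set of $j$ elements into $m$ nonempty subsets, and $S(0,0)=1$. Equivalently $x^j=\sum_{i=0}^{j}S(j,i)(x)_i$ where $(x)_i=\prod_{0\le t<i}(x-t)$. The convention $0^0=1$ is used. *)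

(* Defs.v *)
From mathcomp Require Import all_boot all_order all_algebra.

Set Implicit Arguments.
Unset Strict Implicit.
Unset Printing Implicit Defensive.

Import Order.TTheory GRing.Theory Num.Theory.

(* [partition] excludes empty blocks, and the empty family is the unique
   partition of the empty set, so that [stirling2 0 0] is 1. *)
Definition stirling2 (j m : nat) : nat :=
  #|[set P : {set {set 'I_j}} | partition P [set: 'I_j] & #|P| == m]|.

(* For p > 1 and m > 0, [trunc_log p m] is the floor of log_p m; thus log_p m
   is an integer exactly when p to that power is m. *)
Definition delta (p : nat) (a : int) (m : nat) : nat :=
  if [&& (p%:Z %| a)%Z, 0 < trunc_log p m & p ^ trunc_log p m == m]
  then 1 else 0.

(* Main.v *)
(** Let L_m be the linear functional on F_p[X] sending X^j to S(j, m); over Z it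
    extracts the coefficient of the falling factorial (X)_m.  The recurrence of
    the Stirling numbers says L_m ((X - m) g) = L_(m-1) g, so L_m kills every
    multiple of X (X - 1) ... (X - m).  The two sums of the theorem differ by
    L_m (Y^l' - Y^l), where Y = X + a.  Modulo p, with e the exponent of p in
    the modulus,
      X (X - 1) ... (X - m) | (X^p - X)^q = (Y^p - Y)^q = Y^q (Y^(p-1) - 1)^q
    for q = m/p + 1 <= min(l, p^e), and this divides
      Y^l (Y^(p-1) - 1)^(p^e) = Y^l (Y^((p-1) p^e) - 1) | Y^l' - Y^l.
    If p | a and m is a positive power of p, the factor X - m is X = Y, so
    already the exponent q = m/p = p^e of Y^(p-1) - 1 suffices. *)

Require Import Defs.
From mathcomp Require Import all_boot all_order all_algebra all_field.

Import Order.TTheory GRing.Theory Num.Theory.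
Local Open Scope ring_scope.

(** * The Stirling recurrence, by counting set partitions *)

Section Stirling.
Variable T : finType.
Implicit Types (A D B : {set T}) (P Q : {set {set T}}) (x : T) (m : nat).

Definition partitions_in A m : {set {set {set T}}} :=
  [set P | partition P A & #|P| == m].

Lemma partition_notin {D P B x} :
  partition P D -> x \in B -> x \notin D -> B \notin P.
Proof.
move=> partP xB; apply: contraNN => BP.
exact: (subsetP (partitionS partP BP)).
Qed.

Lemma card_partitions_in_singleton x D m : x \notin D ->
  #|[set P in partitions_in (x |: D) m.+1 | [set x] \in P]|
  = #|partitions_in D m|.
Proof.
move=> xD; have notinP Q : partition Q D -> [set x] \notin Q.
  by move=> partQ; apply: partition_notin partQ _ xD; rewrite set11.
have <- : [set [set x] |: Q | Q in partitions_in D m] =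
    [set P in partitions_in (x |: D) m.+1 | [set x] \in P].
  apply/setP=> P; apply/imsetP/idP => [[Q /[!inE]/andP[partQ /eqP <-] ->]|].
    rewrite !inE eqxx /= andbT cardsU1 notinP // eqxx andbT.
    apply: partitionU1 => //; first by apply/set0Pn; exists x; rewrite set11.
    by rewrite disjoints1.
  rewrite !inE => /andP[/andP[partP /eqP cardP] xP].
  exists (P :\ [set x]); last by rewrite setD1K.
  rewrite inE; have := partitionD1 partP xP; rewrite setU1K // => -> /=.
  by have := cardsD1 [set x] P; rewrite xP cardP => -[->].
apply: card_in_imset => Q1 Q2; rewrite !inE => /andP[/notinP n1 _].
by case/andP=> /notinP n2 _ /(congr1 (fun P => P :\ [set x])); rewrite !setU1K.
Qed.

Definition insert_in_block x (QB : {set {set T}} * {set T}) : {set {set T}} :=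
  (x |: QB.2) |: (QB.1 :\ QB.2).

(** The enlarged block is the only one containing [x], so it can be recognised in the image;
    deleting [x] from it gives back [B], and putting [B] back in its place gives back [Q]. *)
Lemma insert_in_block_inj x D : x \notin D ->
  {in [set QB | partition QB.1 D && (QB.2 \in QB.1)] &,
    injective (insert_in_block x)}.
Proof.
move=> xD [Q B] [Q' B'] /[!inE]/= /andP[partQ BQ] /andP[partQ' BQ'] eqI.
have xB : x \notin B by apply: contraNN xD; apply/subsetP/(partitionS partQ).
have xB' : x \notin B' by apply: contraNN xD; apply/subsetP/(partitionS partQ').
have eqB : x |: B = x |: B'.
  have: x |: B' \in insert_in_block x (Q, B) by rewrite eqI !inE eqxx.
  rewrite !inE eq_sym => /orP[/eqP //|/andP[_ /=]].
  by rewrite (negPf (partition_notin partQ _ xD)) // setU11.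
have {eqB} eqB : B = B' by rewrite -(setU1K xB) eqB setU1K.
rewrite -{B'}eqB in eqI xB' BQ' *; congr pair.
rewrite -(setD1K BQ) -(setD1K BQ').
move/(congr1 (fun P => B |: P :\ (x |: B))): eqI.
rewrite /insert_in_block /= !setU1K // !inE negb_and.
  by rewrite (partition_notin partQ' _ xD) ?orbT // setU11.
by rewrite (partition_notin partQ _ xD) ?orbT // setU11.
Qed.

Lemma card_insert_in_block x D Q B : x \notin D -> partition Q D -> B \in Q ->
  #|insert_in_block x (Q, B)| = #|Q|.
Proof.
move=> xD partQ BQ; rewrite cardsU1 /= inE negb_and.
rewrite (partition_notin partQ _ xD) ?setU11 // orbT.
by rewrite (cardsD1 B Q) BQ.
Qed.

Lemma insert_in_block_partition x D Q B :
  x \notin D -> partition Q D -> B \in Q ->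
  partition (insert_in_block x (Q, B)) (x |: D).
Proof.
move=> xD partQ BQ; have sBD := partitionS partQ BQ.
have -> : x |: D = (x |: B) :|: (D :\: B).
  by rewrite -setUA -{1}(setID D B) (setIidPr sBD).
apply: partitionU1 (partitionD1 partQ BQ) _ _.
  by apply/set0Pn; exists x; rewrite setU11.
rewrite -setI_eq0; apply/eqP/setP=> y; rewrite !inE.
by have [->|_] := eqVneq y x; rewrite ?(negPf xD) ?andbF //=; case: (y \in B).
Qed.

(** Such a partition arises exactly once by choosing a partition of [D] and then one of its [m]
    blocks to receive [x]. *)
Lemma card_partitions_in_insert x D m : x \notin D ->
  #|[set P in partitions_in (x |: D) m | [set x] \notin P]|
  = (m * #|partitions_in D m|)%N.
Proof.
move=> xD.
pose W := [set QB : {set {set T}} * {set T} |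
             (QB.1 \in partitions_in D m) && (QB.2 \in QB.1)].
have <- : #|W| = (m * #|partitions_in D m|)%N.
  rewrite mulnC -sum_nat_const -sum1_card.
  rewrite (eq_bigl _ _ (in_set _)) -(pair_big_dep (mem (partitions_in D m))
    (fun Q B => B \in Q) (fun _ _ => 1%N)) /=.
  by apply: eq_bigr => Q; rewrite inE => /andP[_ /eqP <-]; rewrite sum1_card.
rewrite -(card_in_imset (f := insert_in_block x) (D := W)); last first.
  apply: sub_in2 (insert_in_block_inj x D xD) => -[Q B].
  by rewrite !inE /= => /andP[/andP[-> _] ->].
apply: eq_card => P; apply/idP/imsetP => [|[[Q B]]]; last first.
  rewrite !inE /= => /andP[/andP[partQ /eqP <-] BQ ->].
  rewrite insert_in_block_partition // (card_insert_in_block _ _ _ _ xD partQ) //.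
  rewrite eqxx /= /insert_in_block !inE /= negb_or negb_and.
  rewrite (partition_notin partQ _ xD) ?set11 // orbT andbT.
  (* If the enlarged block were the singleton of [x], then [B] would be empty. *)
  apply: contraNneq (partition_neq0 partQ BQ) => eqx.
  apply/eqP/setP=> y; rewrite [RHS]inE; apply/negP=> yB.
  have: y \in [set x] by rewrite eqx !inE yB orbT.
  rewrite inE => /eqP eqyx; case/negP: xD; rewrite -eqyx.
  exact: (subsetP (partitionS partQ BQ)).
rewrite !inE => /andP[/andP[partP /eqP cardP] xP].
have xcov : x \in cover P by rewrite (cover_partition partP) setU11.
(* The preimage is found by deleting [x] from its block [C]; what remains is nonempty because [x] is
   not alone. *)
set C := pblock P x; have CP : C \in P by apply: pblock_mem.
have xC : x \in C by rewrite mem_pblock.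
have sC := partitionS partP CP.
have C'neq0 : C :\ x != set0.
  apply: contraNneq xP => C'0.
  by rewrite -(setD1K xC) C'0 setU0 in CP.
have partQ : partition ((C :\ x) |: (P :\ C)) D.
  have -> : D = (C :\ x) :|: ((x |: D) :\: C).
    apply/setP=> y; rewrite !inE; have [->|neq] /= := eqVneq y x.
      by rewrite xC (negPf xD).
    have [yC|] //= := boolP (y \in C).
    by have := subsetP sC _ yC; rewrite !inE (negPf neq).
  apply: partitionU1 (partitionD1 partP CP) C'neq0 _.
  rewrite -setI_eq0; apply/eqP/setP=> y; rewrite !inE.
  by case: (y \in C); rewrite ?andbF.
have C'P : C :\ x \notin P :\ C.
  have [y yC'] := set0Pn _ C'neq0.
  apply: (partition_notin (partitionD1 partP CP) yC').
  by move: yC'; rewrite !inE => /andP[_ ->].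
exists ((C :\ x) |: (P :\ C), C :\ x); last first.
  by rewrite /insert_in_block /= setD1K // setU1K // setD1K.
by rewrite !inE /= partQ eqxx /= andbT cardsU1 C'P -cardP (cardsD1 C P) CP.
Qed.

End Stirling.

Fixpoint stirling2_rec (j m : nat) : nat :=
  match j, m with
  | 0, 0 => 1
  | 0, _.+1 => 0
  | _.+1, 0 => 0
  | j'.+1, m'.+1 => stirling2_rec j' m' + m * stirling2_rec j' m
  end.

Lemma card_partitions_in (T : finType) (A : {set T}) m :
  #|partitions_in T A m| = stirling2_rec #|A| m.
Proof.
have [n] := ubnP #|A|; elim: n => // n IHn in A m * => leAn.
have [->|[x xA]] := set_0Vmem A.
  rewrite cards0; have -> : partitions_in T set0 m = if m is 0 then [set set0] else set0.
    case: m => [|m]; apply/setP=> P; rewrite !inE partition_set0.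
      by have [->|] := eqVneq P set0; rewrite ?cards0.
    by have [->|] := eqVneq P set0; rewrite ?cards0.
  by case: m => [|m]; rewrite ?cards1 ?cards0.
have xD : x \notin A :\ x by rewrite !inE eqxx.
rewrite -(setD1K xA) cardsU1 xD add1n.
have ltD : (#|A :\ x| < n)%N by move: leAn; rewrite (cardsD1 x A) xA.
case: m => [|m] /=.
  apply: eq_card0 => P; rewrite !inE; apply/negP=> /andP[partP].
  rewrite cards_eq0 => /eqP P0; move: partP; rewrite P0 => /cover_partition.
  rewrite /cover big_set0 => /setP/(_ x); rewrite !inE eqxx //.
rewrite -!IHn // -(card_partitions_in_singleton _ x) //.
rewrite -(card_partitions_in_insert _ x) //.
(* Split the partitions according to whether [x] is alone in its block. *)
rewrite -(cardsID [set P : {set {set T}} | [set x] \in P]).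
by congr addn; apply: eq_card => P; rewrite !inE // andbC.
Qed.

Lemma stirling2E j m : stirling2 j m = stirling2_rec j m.
Proof.
by rewrite -[in RHS](card_ord j) -cardsT -card_partitions_in.
Qed.

(** * The functional L_m over a commutative ring *)

Section StirlingFunctional.
Variable R : comNzRingType.
Implicit Type g : {poly R}.

Definition stirling2_fun (m : nat) g : R :=
  \sum_(j < size g) g`_j * (stirling2_rec j m)%:R.

(** Coefficients past the size vanish, so polynomials of different sizes can be summed over one
    common range. *)
Lemma stirling2_fun_wide n m g : (size g <= n)%N ->
  stirling2_fun m g = \sum_(j < n) g`_j * (stirling2_rec j m)%:R.
Proof.
move=> le_gn; rewrite /stirling2_fun.
rewrite (big_ord_widen n (fun j => g`_j * (stirling2_rec j m)%:R) le_gn).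
rewrite big_mkcond /=; apply: eq_bigr => j _.
by case: ltnP => // /(nth_default 0) ->; rewrite mul0r.
Qed.

Lemma stirling2_funB m g h :
  stirling2_fun m (g - h) = stirling2_fun m g - stirling2_fun m h.
Proof.
pose n := maxn (size g) (size h).
rewrite !(@stirling2_fun_wide n) ?leq_maxl ?leq_maxr //; last first.
  by rewrite (leq_trans (size_polyD _ _)) // size_polyN.
by rewrite -sumrB; apply: eq_bigr => j _; rewrite coefB mulrBl.
Qed.

Lemma stirling2_fun_mulXsubn m g :
  stirling2_fun m (('X - m%:R%:P) * g) =
  if m is m'.+1 then stirling2_fun m' g else 0.
Proof.
have leX : (size ('X * g)%R <= (size g).+1)%N.
  by rewrite (leq_trans (size_polyMleq _ _)) // size_polyX.
rewrite mulrBl stirling2_funB (stirling2_fun_wide _ _ _ leX).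
rewrite (@stirling2_fun_wide (size g) m (m%:R%:P * g)); last first.
  by rewrite mul_polyC size_scale_leq.
(* The constant term of X g is 0; after the shift, g_j is multiplied by S(j+1, m) - m S(j, m), to
   which the recurrence applies. *)
rewrite big_ord_recl coefXM mul0r add0r -sumrB.
case: m => [|m].
  by apply: big1 => j _; rewrite /= mulr0 mul0r coef0 mul0r subrr.
apply: eq_bigr => j _.
rewrite coefXM coefCM /= natrD natrM mulrDr [_%:R * g`_j]mulrC -mulrA.
by rewrite addrK.
Qed.

(** Each factor X - i, taken from the top, lowers the index by one, until the factor X meets L_0 and
    gives 0. *)
Lemma stirling2_fun_mul_falling m g :
  stirling2_fun m (\prod_(i < m.+1) ('X - i%:R%:P) * g) = 0.
Proof.
elim: m g => [|m IHm] g; rewrite big_ord_recr /=.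
  by rewrite big_ord0 mul1r (stirling2_fun_mulXsubn 0).
by rewrite -mulrA mulrCA stirling2_fun_mulXsubn IHm.
Qed.

Lemma stirling2_fun_XaddC_exp m (c : R) n :
  stirling2_fun m (('X + c%:P) ^+ n) =
  \sum_(j < n.+1) 'C(n, j)%:R * (stirling2_rec j m)%:R * c ^+ (n - j).
Proof.
have -> : ('X + c%:P) ^+ n = \poly_(i < n.+1) (c ^+ (n - i) *+ 'C(n, i)).
  rewrite poly_def addrC exprDn; apply: eq_bigr => i _.
  by rewrite -mul_polyC polyCMn polyC_exp mulrnAl.
rewrite (@stirling2_fun_wide n.+1) ?size_poly //; apply: eq_bigr => j _.
by rewrite coef_poly ltn_ord -mulr_natl mulrAC.
Qed.

End StirlingFunctional.

(** * Falling factorials and powers over F_p *)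

Section FallingModP.
Variable p : nat.
Hypothesis p_prime : prime p.

Lemma pchar_polyFp : p \in [pchar {poly 'F_p}].
Proof. by rewrite pchar_poly pchar_Fp. Qed.

Lemma prod_XsubFp : \prod_(i < p) ('X - i%:R%:P) = 'X^p - 'X :> {poly 'F_p}.
Proof.
have -> : 'X^p = 'X^#|'F_p| :> {poly 'F_p} by rewrite card_Fp.
(* The product over all elements of ['F_p] is indexed by an ordinal type whose bound equals [p] only
   propositionally, hence the cast. *)
rewrite finField_genPoly; have castE n : n = p ->
    \prod_(i < p) ('X - i%:R%:P) = \prod_(i < n) ('X - i%:R%:P) :> {poly 'F_p}.
  by move=> ->.
by rewrite (castE _ (Fp_cast p_prime)); apply: eq_bigr => i _; rewrite natr_Zp.
Qed.

(** Modulo p, every run of p consecutive factors has the same roots as the first. *)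
Lemma falling_mulp q :
  \prod_(i < q * p) ('X - i%:R%:P) = ('X^p - 'X) ^+ q :> {poly 'F_p}.
Proof.
elim: q => [|q IHq]; first by rewrite big_ord0.
rewrite mulSn addnC big_split_ord /= IHq exprSr -prod_XsubFp; congr (_ * _).
by apply: eq_bigr => i _; rewrite natrD natrM pchar_Fp_0 // mulr0 add0r.
Qed.

Lemma dvdp_falling n k : (n <= k)%N ->
  (\prod_(i < n) ('X - i%:R%:P) : {poly 'F_p}) %| \prod_(i < k) ('X - i%:R%:P).
Proof. by move/subnKC <-; rewrite big_split_ord dvdp_mulIl. Qed.

Lemma XaddC_Frobenius_sub (c : 'F_p) :
  ('X + c%:P) ^+ p - ('X + c%:P) = 'X^p - 'X.
Proof.
have c_p : c ^+ p = c by have := expf_card c; rewrite card_Fp.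
rewrite exprDn_pchar ?pnatE ?pchar_polyFp // -polyC_exp c_p.
by rewrite opprD addrACA subrr addr0.
Qed.

(** Raising [q] to p^e lets Frobenius turn the power into Y^((p-1) p^e) - 1, which divides Y^(l'-l)
    - 1. The exponents [k] and [q] are separate because they differ by one in the exceptional
    case. *)
Lemma dvdp_expB_pchar (Y : {poly 'F_p}) (q k l l' e : nat) :
  (q <= p ^ e)%N -> (k <= l)%N -> (l <= l')%N ->
  (l' = l %[mod (p - 1) * p ^ e])%N ->
  Y ^+ k * (Y ^+ (p - 1) - 1) ^+ q %| Y ^+ l' - Y ^+ l.
Proof.
move=> le_q le_k le_l /eqP; rewrite eqn_mod_dvd // => /dvdnP[d def_d].
rewrite -{1}(subnKC le_l) exprD -{2}[Y ^+ l]mulr1 -mulrBr.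
apply: dvdp_mul; first exact: dvdp_exp2l.
apply: (dvdp_trans (dvdp_exp2l _ le_q)).
have p_nat : [pchar {poly 'F_p}].-nat (p ^ e)%N.
  by rewrite pnatX pnatE // pchar_polyFp.
have -> : (Y ^+ (p - 1) - 1) ^+ (p ^ e) = Y ^+ (p - 1) ^+ (p ^ e) - 1.
  have := exprDn_pchar (Y ^+ (p - 1) - 1) 1 p_nat.
  by rewrite subrK expr1n => ->; rewrite addrK.
rewrite -exprM def_d [(d * _)%N]mulnC [Y ^+ (_ * d)]exprM; move: (Y ^+ _) => z.
by have := subrXX z 1 d; rewrite expr1n => ->; apply: dvdp_mulIl.
Qed.

End FallingModP.

Lemma dvdp_falling_expB (p : nat) (a : int) (l l' m : nat) :
  prime p -> (0 < m)%N -> (m %/ p < l)%N -> (l <= l')%N ->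
  (l' = l %[mod (p - 1) * p ^ (trunc_log p m - delta p a m)])%N ->
  (\prod_(i < m.+1) ('X - i%:R%:P) : {poly 'F_p})
    %| ('X + a%:~R%:P) ^+ l' - ('X + a%:~R%:P) ^+ l.
Proof.
move=> p_prime m_gt0 lt_mpl le_ll'.
have p_gt0 := prime_gt0 p_prime; have p_gt1 := prime_gt1 p_prime.
have factor (Y : {poly 'F_p}) : Y ^+ p - Y = Y * (Y ^+ (p - 1) - 1).
  by rewrite mulrBr mulr1 -exprS subn1 prednK.
rewrite /delta; case: ifP => [/and3P[p_dvd_a log_gt0 /eqP m_def]|_] eq_ll'.
  have -> : a%:~R = 0 :> 'F_p by apply/eqP; rewrite -(dvdz_pcharf (pchar_Fp p_prime)).
  (* Here [e] is log_p m, so the modulus has exponent e - 1; the lemma is applied with q = m/p =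
     p^(e-1) and k = q + 1. *)
  rewrite addr0; set e := trunc_log p m in eq_ll' log_gt0 m_def.
  have mE : m = (p ^ (e - 1) * p)%N by rewrite -expnSr -addn1 subnK.
  rewrite big_ord_recr /= mE falling_mulp // natrM pchar_Fp_0 // mulr0 subr0.
  rewrite factor exprMn mulrAC -exprSr.
  by apply: dvdp_expB_pchar eq_ll' => //; move: lt_mpl; rewrite mE mulnK.
rewrite subn0 in eq_ll'.
(* From m < p^(e+1), with e the floor of log_p m, one gets m/p + 1 <= p^e for the integer quotient,
   as the choice k = q = m/p + 1 requires. *)
have /andP[_ lt_m] := trunc_log_bounds p_gt1 m_gt0.
have le_m : (m.+1 <= (m %/ p).+1 * p)%N by rewrite ltn_ceil.
apply: (dvdp_trans (dvdp_falling p _ _ le_m)).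
rewrite falling_mulp // -(XaddC_Frobenius_sub p p_prime a%:~R) factor exprMn.
apply: dvdp_expB_pchar eq_ll' => //.
by rewrite ltn_divLR // -expnSr.
Qed.

Theorem theorem1p1 (p : nat) (a : int) (l l' m : nat)
    (p_prime : prime p)
    (l_gt0 : (0 < l)%N) (l'_gt0 : (0 < l')%N) (m_gt0 : (0 < m)%N)
    (le_l_l' : (l <= l')%N)
    (lt_mp_l : m%:R / p%:R < l%:R :> rat)
    (eq_l_l' : (l' = l %[mod (p - 1) * p ^ (trunc_log p m - delta p a m)])%N) :
  (\sum_(j < l'.+1) 'C(l', j)%:Z * (stirling2 j m)%:Z * a ^+ (l' - j)
   = \sum_(j < l.+1) 'C(l, j)%:Z * (stirling2 j m)%:Z * a ^+ (l - j)
   %[mod p%:Z])%Z.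
Proof.
have {}lt_mp_l : (m %/ p < l)%N.
  move: lt_mp_l; rewrite ltr_pdivrMr ?ltr0n ?prime_gt0 //.
  by rewrite -natrM ltr_nat ltn_divLR ?prime_gt0.
(* The congruence is tested on images in ['F_p], where each sum is L_m of a power of X + a. *)
have sumE n : (\sum_(j < n.+1) 'C(n, j)%:Z * (stirling2 j m)%:Z * a ^+ (n - j))%:~R
    = stirling2_fun 'F_p m (('X + a%:~R%:P) ^+ n).
  rewrite stirling2_fun_XaddC_exp rmorph_sum /=; apply: eq_bigr => j _.
  by rewrite !rmorphM rmorphXn /= stirling2E.
apply/eqP; rewrite eqz_mod_dvd (dvdz_pcharf (pchar_Fp p_prime)) rmorphB /= !sumE.
rewrite -stirling2_funB.
have /dvdpP[g ->] := dvdp_falling_expB _ _ _ _ _ p_prime m_gt0 lt_mp_l le_l_l' eq_l_l'.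
by rewrite mulrC stirling2_fun_mul_falling.
Qed.
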